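(* Assume the grading is strong. For each quotient-up-component $\underline C_k$ in dimension $k$ of $\underline\Gamma$, the distribution $\pi_{\underline C_k}(\underline u)=\mathrm{LP}(\underline u)\mathrm{RP}(\underline u)/K_{\underline C_k}$ ($\underline u\in\underline C_k$), where $K_{\underline C_k}$ is the number of root-to-leaf paths containing a node of $\underline C_k$, satisfies the reversibility condition for the quotient up-walk; hence it is the stationary distribution associated with $\underline C_k$. Moreover, the distribution $\pi_{C_k}(u)=\pi_{\underline C_k}(\underline u)/2=\mathrm{LP}(\underline u)\mathrm{RP}(\underline u)/(2K_{\underline C_k})$ on $C_k=\{u:\underline u\in\underline C_k\}$ satisfies the reversibility condition for the up-walk on $\Gamma$. The same holds with ''up'' replaced by ''down''.
   Context: A double cover of a graded signed graph is $\Gamma=(X,E,[\cdot:\cdot],\dim,-)$: $X$ finite nonempty, $E$ directed edges ($u\subset v$), signature $[v:u]\in\{\pm1\}$, $\dim:X\to\mathbb Z$, $-$ a fixed-point-free involution, with $u\subset v\Rightarrow\dim u<\dim v$, $-u\subset v$, $u\subset-v$, $[-v:u]=[v:-u]=-[v:u]$, and $\dim(-u)=\dim u$. Strong grading: $u\subset v\Rightarrow\dim v=\dim u+1$. Quotient $\underline\Gamma$: nodes $\underline u=\{u,-u\}$, edges $\underline u\subset\underline v$ iff $u\subset v$. Leaf: no $\underline v\supset\underline u$; root: no $\underline t\subset\underline u$. $\mathrm{LP}=1$ on leaves, $\sum_{\underline v\supset\underline u}\mathrm{LP}(\underline v)$ otherwise; $\mathrm{RP}=1$ on roots, $\sum_{\underline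 t\subset\underline u}\mathrm{RP}(\underline t)$ otherwise. A root-to-leaf path is a sequence $\underline w_0\subset\dots\subset\underline w_n$ from a root to a leaf. Up-walk on $X_k$: for $\underline u$ not a leaf, $P(u,u')=\sum\frac{\mathrm{LP}(\underline v)\mathrm{RP}(\underline u')}{\mathrm{LP}(\underline u)\mathrm{RP}(\underline v)}$ over $v\in X$ with $v\supset u,u'$, $[v:u]=1$, $[v:u']=-1$; for $\underline u$ a leaf, $P(u,u')=1/2$ if $u'\in\{\pm u\}$ and $0$ otherwise. Quotient up-walk on $\underline X_k$: for $\underline u$ not a leaf, $P(\underline u,\underline u')=\sum_{\underline v\supset\underline u,\underline u'}\frac{\mathrm{LP}(\underline v)\mathrm{RP}(\underline u')}{\mathrm{LP}(\underline u)\mathrm{RP}(\underline v)}$; for leaves $P(\underline u,\underline u)=1$. Down-walks dually: for $\underline u$ not a root, $P(u,u')=\sum\frac{\mathrm{RP}(\underline t)\mathrm{LP}(\underline u')}{\mathrm{RP}(\underline u)\mathrm{LP}(\underline t)}$ over $t\subset u,u'$, $[u:t]=-1$, $[u':t]=1$ (quotient: over $\underline t\subset\underline u,\underline u'$); for roots $P(u,\pm u)=1/2$ (quotient $1$). Quotient-up-(down-)components in dimension $k$: maximal subsets of $\underline X_k$ connected under up-adjacency (distinct nodes lying below a common node of dimension $k+1$), resp. down-adjacency (distinct nodes lying above a common node of dimension $k-1$). *)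

(* Defs.v *)
From HB Require Import structures.
From mathcomp Require Import all_boot all_order all_algebra.

Set Implicit Arguments.
Unset Strict Implicit.
Unset Printing Implicit Defensive.

Import Order.TTheory GRing.Theory Num.Theory.
Local Open Scope ring_scope.

(* [edge u v] reads "u is a face of v" (u ⊂ v); [sgn v u] is the signature
   [v : u], meaningful only when [edge u v] holds. *)
Record doubleCover := DoubleCover {
  node :> finType;
  edge : rel node;
  sgn : node -> node -> int;
  dim : node -> int;
  neg : node -> node;
  _ : (0 < #|node|)%N;
  sgn_unit : forall u v, edge u v -> sgn v u = 1 \/ sgn v u = -1;
  negK : involutive neg;
  neg_neq : forall u, neg u <> u;
  edge_dim : forall u v, edge u v -> dim u < dim v;
  edge_negl : forall u v, edge u v -> edge (neg u) v;
  edge_negr : forall u v, edge u v -> edge u (neg v);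
  sgn_negl : forall u v, edge u v -> sgn (neg v) u = - sgn v u;
  sgn_negr : forall u v, edge u v -> sgn v (neg u) = - sgn v u;
  dim_neg : forall u, dim (neg u) = dim u }.

Definition strongly_graded (G : doubleCover) : Prop :=
  forall u v : G, edge u v -> dim v = dim u + 1.

Section PathCount.
Variables (T : finType) (r : rel T).

Definition sink (u : T) : bool := [forall v, ~~ r u v].

Fixpoint sink_count_rec (n : nat) (u : T) : nat :=
  if n is m.+1 then
    if sink u then 1%N else (\sum_(v | r u v) sink_count_rec m v)%N
  else 0%N.

(* When [r] is acyclic, #|T| steps always suffice: see [sink_countE]. *)
Definition sink_count (u : T) : nat := sink_count_rec #|T| u.

Hypothesis acyclic : forall x p, path r x p -> uniq (x :: p).

Lemma acyclic_size x p : path r x p -> (size p < #|T|)%N.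
Proof. by move=> /acyclic /card_uniqP cardp; rewrite -[(size p).+1]cardp max_card. Qed.

Lemma sink_countE u :
  sink_count u = if sink u then 1%N else (\sum_(v | r u v) sink_count v)%N.
Proof.
have stable n : forall w, (forall p, path r w p -> (size p < n)%N) ->
    sink_count_rec n w = sink_count_rec n.+1 w.
  elim: n => [w /(_ [::] isT) // | n IHn w Hw].
  rewrite /= -/(sink_count_rec n.+1); case: ifP => // _.
  apply: eq_bigr => v rwv; apply: IHn => p pvp.
  by apply: (Hw (v :: p)); rewrite /= rwv.
by rewrite {1}/sink_count stable //; exact: acyclic_size.
Qed.

End PathCount.

Section Quotient.
Variable G : doubleCover.

Definition pair_of (u : G) : {set G} := [set u; neg u].

Definition qnode : finType := {A : {set G} | A \in [set pair_of u | u : G]}.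

Definition cls (u : G) : qnode :=
  exist _ (pair_of u) (imset_f pair_of (isT : u \in G)).

Definition qedge : rel qnode :=
  [rel A B : qnode | [exists u in val A, exists v in val B, edge u v]].

Definition qlayer (k : int) : {set qnode} := [set cls u | u : G & dim u == k].

Definition is_leaf : pred qnode := sink qedge.
Definition is_root : pred qnode := sink [rel A B | qedge B A].
Definition LP : qnode -> nat := sink_count qedge.
Definition RP : qnode -> nat := sink_count [rel A B | qedge B A].

Definition root_leaf_path (w : seq qnode) : bool :=
  if w is x :: p then
    [&& is_root x, path qedge x p & is_leaf (last x p)]
  else false.

(* Every root-to-leaf path has at most #|qnode| nodes: see
   [root_leaf_path_size]. *)
Definition npaths_through (C : {set qnode}) : nat :=
  #|[set w : {bseq #|qnode| of qnode} | root_leaf_path w && has (mem C) w]|.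

Definition up_adj (k : int) : rel qnode :=
  [rel A B | (A != B) && [exists D in qlayer (k + 1), qedge A D && qedge B D]].
Definition down_adj (k : int) : rel qnode :=
  [rel A B | (A != B) && [exists D in qlayer (k - 1), qedge D A && qedge D B]].

Definition connected_set (adj : rel qnode) (C : {set qnode}) : bool :=
  (C != set0) &&
  [forall A in C, forall B in C,
     connect [rel A' B' | [&& A' \in C, B' \in C & adj A' B']] A B].

Definition up_component (k : int) (C : {set qnode}) : bool :=
  maxset (fun D => (D \subset qlayer k) && connected_set (up_adj k) D) C.
Definition down_component (k : int) (C : {set qnode}) : bool :=
  maxset (fun D => (D \subset qlayer k) && connected_set (down_adj k) D) C.

Lemma cls_surj (A : qnode) : exists u, A = cls u.
Proof.
by case: A => A AP; have /imsetP[u _ Au] := AP; exists u; apply: val_inj.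
Qed.

Lemma mem_cls (u v : G) : (u \in val (cls v)) = (u == v) || (u == neg v).
Proof. by rewrite /= !inE. Qed.

Lemma cls_neg (u : G) : cls (neg u) = cls u.
Proof. by apply: val_inj; rewrite /= /pair_of negK setUC. Qed.

Lemma qedgeE (u v : G) : qedge (cls u) (cls v) = edge u v.
Proof.
apply/idP/idP => [/existsP[u' /andP[+ /existsP[v' /andP[+ e]]]]|e].
  rewrite !mem_cls => /orP[] /eqP eu /orP[] /eqP ev; move: e; rewrite eu ev => e //.
  - by rewrite -(negK v); apply: edge_negr.
  - by rewrite -(negK u); apply: edge_negl.
  - by rewrite -(negK u) -(negK v); apply: edge_negl; apply: edge_negr.
apply/existsP; exists u; rewrite mem_cls eqxx /=.
by apply/existsP; exists v; rewrite mem_cls eqxx.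
Qed.

Lemma qdim_ex : exists f : qnode -> int, forall u, f (cls u) = dim u.
Proof.
have ex A : exists u, A == cls u by have [u ->] := cls_surj A; exists u.
exists (fun A => dim (xchoose (ex A))) => u.
have := xchooseP (ex (cls u)).
move: (xchoose _) => v /eqP/(congr1 val)/setP/(_ u).
rewrite !mem_cls eqxx /= => /esym/orP[] /eqP -> //.
by rewrite dim_neg.
Qed.

Lemma mem_qlayer (k : int) (u : G) : (cls u \in qlayer k) = (dim u == k).
Proof.
have [f fE] := qdim_ex.
apply/imsetP/idP => [[v + /(congr1 f)]|ku]; last by exists u; rewrite ?inE.
by rewrite inE !fE => /eqP <- ->.
Qed.

Lemma qedge_acyclic x p : path qedge x p -> uniq (x :: p).
Proof.
have [f fE] := qdim_ex.
have sub : subrel qedge [rel A B | f A < f B].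
  move=> A B; have [u ->] := cls_surj A; have [v ->] := cls_surj B.
  by rewrite qedgeE /= !fE; apply: edge_dim.
move=> /(sub_path sub) xp.
apply: (@sorted_uniq _ [rel A B | f A < f B] _ _ (x :: p)) => //.
  by move=> B A D /=; apply: lt_trans.
by move=> A /=; apply: ltxx.
Qed.

Lemma qedge_acyclicV x p : path [rel A B | qedge B A] x p -> uniq (x :: p).
Proof.
rewrite -[path _ x p](rev_path qedge) => /qedge_acyclic.
by rewrite -rev_rcons -lastI rev_uniq.
Qed.

Lemma LPE (A : qnode) :
  LP A = if is_leaf A then 1%N else (\sum_(B | qedge A B) LP B)%N.
Proof. exact: (sink_countE qedge_acyclic). Qed.

Lemma RPE (A : qnode) :
  RP A = if is_root A then 1%N else (\sum_(B | qedge B A) RP B)%N.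
Proof. exact: (sink_countE qedge_acyclicV). Qed.

Lemma root_leaf_path_size (w : seq qnode) :
  root_leaf_path w -> (size w <= #|qnode|)%N.
Proof.
by case: w => // x p /and3P[_ xp _]; apply: (acyclic_size qedge_acyclic xp).
Qed.

End Quotient.

Section Walks.
Variables (R : realFieldType) (G : doubleCover).

Definition up_walk (u u' : G) : R :=
  if is_leaf (cls u) then (if u' \in [set u; neg u] then 1 / 2 else 0) else
  \sum_(v : G | [&& edge u v, edge u' v, sgn v u == 1 & sgn v u' == -1])
     ((LP (cls v))%:R * (RP (cls u'))%:R) / ((LP (cls u))%:R * (RP (cls v))%:R).

Definition qup_walk (A A' : qnode G) : R :=
  if is_leaf A then (if A' == A then 1 else 0) else
  \sum_(B : qnode G | qedge A B && qedge A' B)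
     ((LP B)%:R * (RP A')%:R) / ((LP A)%:R * (RP B)%:R).

Definition down_walk (u u' : G) : R :=
  if is_root (cls u) then (if u' \in [set u; neg u] then 1 / 2 else 0) else
  \sum_(t : G | [&& edge t u, edge t u', sgn u t == -1 & sgn u' t == 1])
     ((RP (cls t))%:R * (LP (cls u'))%:R) / ((RP (cls u))%:R * (LP (cls t))%:R).

Definition qdown_walk (A A' : qnode G) : R :=
  if is_root A then (if A' == A then 1 else 0) else
  \sum_(B : qnode G | qedge B A && qedge B A')
     ((RP B)%:R * (LP A')%:R) / ((RP A)%:R * (LP B)%:R).

(* Distributions on a component are extended by zero to all nodes. *)
Definition quot_pi (C : {set qnode G}) (A : qnode G) : R :=
  if A \in C then ((LP A)%:R * (RP A)%:R) / (npaths_through C)%:R else 0.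

Definition cover_pi (C : {set qnode G}) (u : G) : R := quot_pi C (cls u) / 2.

Definition layer (k : int) : {set G} := [set u | dim u == k].

Definition cover_of (C : {set qnode G}) : {set G} := [set u | cls u \in C].

End Walks.

Section MarkovChains.
Variables (R : realFieldType) (T : finType).
(* [S] is the state space and [P] the transition matrix, read on S x S. *)
Implicit Types (S C : {set T}) (P : T -> T -> R) (mu : T -> R).

Definition distribution_on C mu : Prop :=
  [/\ forall x, 0 <= mu x,
      forall x, x \notin C -> mu x = 0 &
      \sum_(x in C) mu x = 1].

Definition reversible S P mu : Prop :=
  forall x y, x \in S -> y \in S -> mu x * P x y = mu y * P y x.

Definition stationary S P mu : Prop :=
  forall y, y \in S -> \sum_(x in S) mu x * P x y = mu y.

Definition the_stationary_distribution S P C mu : Prop :=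
  [/\ distribution_on C mu, stationary S P mu &
      forall nu, distribution_on C nu -> stationary S P nu -> nu =1 mu].

End MarkovChains.

(* Main.v *)
Require Import Defs.
From HB Require Import structures.
From mathcomp Require Import all_boot all_order all_algebra ring.

(* A root-to-leaf path meets a layer at most once, and those through A are
   counted by LP A * RP A, so K_C is the sum of LP * RP over the component C
   and pi_C has total mass 1. Multiplied by LP A * RP A, the transition
   probability from A to A' becomes the sum of RP A * RP A' * LP B / RP B over
   the common upper neighbours B, which is symmetric in A and A'; upstairs the
   same computation is symmetric after replacing v by -v. Strong grading keeps
   the lower neighbours of B in one layer, which makes the walk stochastic
   there, and uniqueness is the maximum principle on a connected component.
   The down-walk is the up-walk of the opposite double cover. *)

Set Implicit Arguments.
Unset Strict Implicit.
Unset Printing Implicit Defensive.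

Import Order.TTheory GRing.Theory Num.Theory.
Local Open Scope ring_scope.

(** * Finite reversible Markov chains and uniqueness of the stationary distribution *)

Section ReversibleChains.
Variables (R : realFieldType) (T : finType).
Implicit Types (S C : {set T}) (P : T -> T -> R) (mu : T -> R).

Lemma reversible_stationary S P mu :
  (forall x, x \in S -> \sum_(y in S) P x y = 1) ->
  reversible S P mu -> stationary S P mu.
Proof.
move=> P1 rev y yS.
rewrite (eq_bigr (fun x => mu y * P y x)) => [|x xS]; last exact: rev.
by rewrite -mulr_sumr P1 // mulr1.
Qed.

(* Maximum principle: by reversibility the density of a stationary
   distribution with respect to [mu] is harmonic for [P]. *)
Lemma reversible_the_stationary S P C mu :
    C \subset S -> C != set0 ->
    (forall x y, 0 <= P x y) ->
    (forall x, x \in S -> \sum_(y in S) P x y = 1) ->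
    distribution_on C mu -> (forall x, x \in C -> 0 < mu x) ->
    reversible S P mu ->
    (forall x y, x \in C -> y \in C ->
       connect [rel a b | [&& a \in C, b \in C & 0 < P a b]] x y) ->
  the_stationary_distribution S P C mu.
Proof.
move=> /subsetP CS C0 P0 P1 mud mupos rev irr.
split=> //; first exact: reversible_stationary.
move=> nu nud nust; have [_ muC mu1] := mud; have [_ nuC nu1] := nud.
(* Outside [C] both [mu] and [nu] vanish, so the value of the density there does not affect this
   identity. *)
have [f nuE] : exists f : T -> R, forall x, nu x = f x * mu x.
  exists (fun x => nu x / mu x) => x.
  have [/mupos xC|xC] := boolP (x \in C); last by rewrite nuC ?muC ?mulr0.
  by rewrite divfK ?gt_eqF.
have harm y : y \in C -> \sum_(x in S) f x * P y x = f y.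
  move=> yC; have muy : mu y != 0 by rewrite gt_eqF ?mupos.
  apply: (mulIf muy); rewrite -nuE.
  rewrite -(nust y (CS _ yC)) mulr_suml; apply: eq_bigr => x xS.
  by rewrite nuE -!mulrA [mu x * _]rev ?(CS _ yC) // [P y x * _]mulrC.
have [x0 x0C] := set0Pn _ C0.
case: (@Order.TotalTheory.arg_maxP _ _ _ x0 (mem C) f x0C) => m mC fmax.
(* The terms [(f m - f z) * P y z] are nonnegative and, by harmonicity at [y], sum to zero; so the
   maximum spreads along every positive transition inside [C]. For [z] outside [C] the bound on [f]
   fails to apply, but there [mu z = 0] and reversibility force [P y z = 0]. *)
have prop y x : y \in C -> f y = f m -> x \in C -> 0 < P y x -> f x = f m.
  move=> yC fy xC Pyx.
  have term0 z : z \in S -> 0 <= (f m - f z) * P y z.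
    move=> zS; have [zC|zC] := boolP (z \in C).
      by rewrite mulr_ge0 // subr_ge0; exact: fmax.
    have /eqP : mu y * P y z = 0 by rewrite rev ?(CS _ yC) // muC ?mul0r.
    by rewrite mulf_eq0 gt_eqF ?mupos //= => /eqP ->; rewrite mulr0.
  have sum0 : \sum_(z in S) (f m - f z) * P y z = 0.
    under eq_bigr do rewrite mulrBl.
    by rewrite sumrB -mulr_sumr P1 ?CS // mulr1 harm // fy subrr.
  have /eqP := psumr_eq0P term0 sum0 (CS _ xC).
  by rewrite mulf_eq0 (gt_eqF Pyx) orbF subr_eq0 => /eqP.
have fC x : x \in C -> f x = f m.
  move=> /(irr m _ mC) /connectP[p mp ->].
  suff reach y : y \in C -> f y = f m ->
      path [rel a b | [&& a \in C, b \in C & 0 < P a b]] y p ->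
      f (last y p) = f m by exact: reach.
  elim: p {mp} y => [|z p IHp] y yC fy //= /andP[/and3P[_ zC Pyz]].
  by apply: IHp => //; apply: prop Pyz.
have fm1 : f m = 1.
  rewrite -nu1 -[LHS]mulr1 -mu1 mulr_sumr; apply: eq_bigr => x xC.
  by rewrite nuE fC.
move=> x; have [xC|xC] := boolP (x \in C); last by rewrite nuC ?muC.
by rewrite nuE fC // fm1 mul1r.
Qed.

End ReversibleChains.

(** * Enumeration of the paths from a node to a sink in an acyclic relation *)

Section SinkPaths.
Variables (T : finType) (r : rel T).

Lemma eq_sink (r' : rel T) : r =2 r' -> sink r =1 sink r'.
Proof. by move=> rr' u; apply: eq_forallb => v; rewrite rr'. Qed.

Lemma eq_sink_count (r' : rel T) : r =2 r' -> sink_count r =1 sink_count r'.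
Proof.
move=> rr' u; rewrite /sink_count; elim: #|T| u => //= n IHn u.
by rewrite (eq_sink rr'); case: ifP => // _; apply: eq_big => // v; rewrite rr'.
Qed.

(** The lists are path tails, without the starting node, so a sink contributes the empty tail. The
    recursion copies [sink_count_rec], which makes length and count agree by one induction. *)
Fixpoint sink_paths_rec (n : nat) (u : T) : seq (seq T) :=
  if n is m.+1 then
    if sink r u then [:: [::]]
    else [seq v :: p | v <- enum (r u), p <- sink_paths_rec m v]
  else [::].

Definition sink_paths (u : T) : seq (seq T) := sink_paths_rec #|T| u.

Lemma size_sink_paths u : size (sink_paths u) = sink_count r u.
Proof.
rewrite /sink_paths /sink_count; elim: #|T| u => //= n IHn u.
case: ifP => // _; rewrite size_allpairs_dep sumnE big_map big_enum /=.
by apply: eq_bigr => v _; rewrite IHn.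
Qed.

Lemma sink_paths_uniq u : uniq (sink_paths u).
Proof.
rewrite /sink_paths; elim: #|T| u => //= n IHn u.
case: ifP => // _; apply: allpairs_uniq_dep; rewrite ?enum_uniq //.
by move=> [v p] [w q] _ _ /= [-> ->].
Qed.

Hypothesis acyclic : forall x p, path r x p -> uniq (x :: p).

Lemma mem_sink_paths u p :
  (p \in sink_paths u) = path r u p && sink r (last u p).
Proof.
(* With fuel [n] exactly the tails shorter than [n] are listed; acyclicity makes this bound
   automatic when [n] is [#|T|]. *)
have mem_rec n v q : (q \in sink_paths_rec n v) =
    [&& (size q < n)%N, path r v q & sink r (last v q)].
  elim: n v q => [|n IHn] v q //=; case: ifPn => sv.
    rewrite inE; case: q => [|w q] /=; first by rewrite sv.
    by rewrite (negbTE (forallP sv w)) /= andbF.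
  apply/allpairsPdep/idP => [[w [s [+ + ->]]]|].
    by rewrite mem_enum IHn ltnS /= unfold_in => -> /and3P[-> -> ->].
  case: q => [|w q] /=; first by rewrite (negbTE sv).
  rewrite ltnS => /and3P[sq /andP[rvw wq] sl]; exists w, q.
  by rewrite mem_enum IHn sq wq sl unfold_in.
rewrite mem_rec; case: (boolP (path r u p)) => [/(acyclic_size acyclic)->|] //.
by rewrite andbF.
Qed.

(** In an acyclic relation the fuel outlasts every path, so the recursion meets a sink before it can
    return its default [0]. This makes [LP] and [RP] invertible in the transition probabilities. *)
Lemma sink_count_gt0 u : (0 < sink_count r u)%N.
Proof.
have pos n v : (forall p, path r v p -> (size p < n)%N) ->
    (0 < sink_count_rec r n v)%N.
  elim: n v => [v /(_ [::] isT) //|n IHn v Hv] /=.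
  case: ifPn => // /forallPn[w]; rewrite negbK => rvw.
  rewrite (bigD1 w) //= addn_gt0 IHn // => p wp.
  by apply: (Hv (w :: p)); rewrite /= rvw.
by apply: pos => p; apply: acyclic_size.
Qed.

End SinkPaths.

(** * Counting root-to-leaf paths through a node and through a subset of a layer *)

Section PathsThrough.
Variable G : doubleCover.
Implicit Types (A B : qnode G) (C : {set qnode G}).

Lemma LP_gt0 A : (0 < LP A)%N.
Proof. exact: sink_count_gt0 (@qedge_acyclic G) A. Qed.

Lemma RP_gt0 A : (0 < RP A)%N.
Proof. exact: sink_count_gt0 (@qedge_acyclicV G) A. Qed.

(** Cutting at [A] leaves an ascending tail [p] and, read backwards, a descending tail [q]; these
    are the tails that [sink_paths] enumerates for [qedge] and for its converse. *)
Lemma root_leaf_path_cat A (q p : seq (qnode G)) :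
  root_leaf_path (rev q ++ A :: p) =
    (path [rel B D | qedge D B] A q && is_root (last A q)) &&
    (path (@qedge G) A p && is_leaf (last A p)).
Proof.
case/lastP: q => [//|q z].
rewrite -[path [rel B D | qedge D B] A _](rev_path (@qedge G)) last_rcons.
rewrite belast_rcons rev_cons rev_rcons /= last_cat /= -cat_rcons cat_path.
by rewrite last_rcons -!andbA andbCA.
Qed.

Definition paths_through A : seq (seq (qnode G)) :=
  [seq rev q ++ A :: p | q <- sink_paths [rel B D | qedge D B] A,
                         p <- sink_paths (@qedge G) A].

Lemma size_paths_through A : size (paths_through A) = (LP A * RP A)%N.
Proof. by rewrite size_allpairs !size_sink_paths mulnC. Qed.

Lemma mem_paths_through A w :
  (w \in paths_through A) = root_leaf_path w && (A \in w).
Proof.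
apply/allpairsP/andP => [[[q p] /= []]|[]].
  rewrite (mem_sink_paths (@qedge_acyclicV G)).
  rewrite (mem_sink_paths (@qedge_acyclic G)) => qP pP ->.
  by rewrite root_leaf_path_cat qP pP mem_cat mem_head orbT.
move=> + Aw; case/splitPr: Aw => q p; rewrite -[q]revK root_leaf_path_cat.
move=> /andP[qP pP]; exists (rev q, p).
by rewrite (mem_sink_paths (@qedge_acyclicV G)) (mem_sink_paths (@qedge_acyclic G)).
Qed.

Lemma root_leaf_path_uniq (w : seq (qnode G)) : root_leaf_path w -> uniq w.
Proof. by case: w => // x p /and3P[_ /qedge_acyclic]. Qed.

(** A root-to-leaf path visits [A] only once, so the position of [A] is the size of [q], and the
    path determines both of its halves. *)
Lemma paths_through_uniq A : uniq (paths_through A).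
Proof.
apply: allpairs_uniq; rewrite ?sink_paths_uniq // => -[q p] [q' p'].
have index_A s t : rev s ++ A :: t \in paths_through A ->
    index A (rev s ++ A :: t) = size s.
  rewrite mem_paths_through => /andP[/root_leaf_path_uniq + _].
  rewrite cat_uniq /= negb_or => /and3P[_ /andP[As _] _].
  by rewrite index_cat (negbTE As) /= eqxx addn0 size_rev.
move=> /allpairsP[[s t] /= [sP tP [-> ->]]] /allpairsP[[s' t'] /= [sP' tP' [-> ->]]].
move=> E; have memE := index_A _ _ (allpairs_f (fun q p => rev q ++ A :: p) sP tP).
have := index_A _ _ (allpairs_f (fun q p => rev q ++ A :: p) sP' tP').
rewrite -E memE => sz; move/eqP: E; rewrite eqseq_cat ?size_rev //.
by move=> /andP[/eqP/(can_inj revK)-> /eqP[->]].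
Qed.

Lemma card_paths_through A :
  #|[set w : {bseq #|qnode G| of qnode G} | root_leaf_path w && (A \in bseqval w)]|
    = (LP A * RP A)%N.
Proof.
rewrite -size_paths_through cardE -(size_map val); apply/perm_size/uniq_perm.
- by rewrite map_inj_uniq ?enum_uniq //; apply: val_inj.
- exact: paths_through_uniq.
move=> w; rewrite mem_paths_through; apply/mapP/idP => [[b]|wP].
  by rewrite mem_enum inE => bP ->.
have /andP[/root_leaf_path_size sw _] := wP.
by exists (Bseq sw); rewrite // mem_enum inE.
Qed.

(** The dimension increases strictly along a path, so equal dimensions force equal positions. *)
Lemma qlayer_antichain (k : int) x p A B :
  path (@qedge G) x p -> A \in x :: p -> B \in x :: p ->
  A \in qlayer G k -> B \in qlayer G k -> A = B.
Proof.
have [f fE] := qdim_ex G.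
have fk D : D \in qlayer G k -> f D = k.
  by have [u ->] := cls_surj D; rewrite mem_qlayer fE => /eqP.
have sub : subrel (@qedge G) [rel D D' | f D < f D'].
  move=> D D'; have [u ->] := cls_surj D; have [v ->] := cls_surj D'.
  by rewrite qedgeE /= !fE; apply: edge_dim.
have tr : transitive [rel D D' | f D < f D'].
  by move=> D1 D2 D3 /=; apply: lt_trans.
move=> /(sub_path sub) xp Axp Bxp /fk fA /fk fB.
have mono D D' : D \in x :: p -> D' \in x :: p ->
    (index D (x :: p) < index D' (x :: p))%N -> f D < f D'.
  move=> Dxp D'xp DD'; rewrite -(nth_index x Dxp) -(nth_index x D'xp).
  by apply: (sorted_ltn_nth tr x (xp : sorted _ (x :: p))) DD';
    rewrite inE index_mem.
suff idxE : index A (x :: p) = index B (x :: p).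
  by rewrite -[A](nth_index x Axp) idxE nth_index.
move: (mono A B Axp Bxp) (mono B A Bxp Axp); rewrite fA fB ltxx.
move: (index A _) (index B _) => i j; case: ltngtP => [_ /(_ isT)|_ _ /(_ isT)|] //.
Qed.

(** Double counting of the pairs of a node of [C] and a root-to-leaf path through it: a path that
    meets [C] does so in a single node, by [qlayer_antichain]. *)
Lemma npaths_throughE (k : int) C : C \subset qlayer G k ->
  npaths_through C = (\sum_(A in C) LP A * RP A)%N.
Proof.
move=> /subsetP Ck.
under eq_bigr do rewrite -card_paths_through -sum1dep_card big_mkcondr /=.
rewrite exchange_big /= /npaths_through -sum1dep_card big_mkcondr /=.
apply: eq_bigr => w wP; case: ifPn => [/hasP[A Aw cA]|wC]; last first.
  rewrite big1 // => A cA; case: ifP => // Aw.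
  by case/hasP: wC; exists A.
rewrite (bigD1 A) //= Aw big1 // => B /andP[cB BA]; case: ifP => // Bw.
case: (bseqval w) wP Aw Bw => // x p /and3P[_ xp _] Aw Bw.
by rewrite (qlayer_antichain xp Bw Aw (Ck _ cB) (Ck _ cA)) eqxx in BA.
Qed.

End PathsThrough.

(** Adjoining [B] to [C] keeps the set connected, since every point is linked to [A]; maximality
    then forces [B |: C] to equal [C]. *)
Lemma component_closed (G : doubleCover) (adj : rel (qnode G))
    (S C : {set qnode G}) A B :
  symmetric adj ->
  maxset (fun D => (D \subset S) && connected_set adj D) C ->
  A \in C -> B \in S -> adj A B -> B \in C.
Proof.
move=> adjC /maxsetP[/andP[CS /andP[C0 conC]] maxC] cA BS AB.
suff <- : B |: C = C by rewrite setU11.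
apply: maxC; last exact: subsetUr.
rewrite subUset sub1set BS CS /=; apply/andP; split.
  by apply/set0Pn; exists B; rewrite setU11.
set e := [rel _ _ | _].
have eC : connect_sym e.
  by apply: sym_connect_sym => x y /=; rewrite adjC andbCA.
have toA x : x \in B |: C -> connect e A x.
  rewrite !inE => /orP[/eqP ->|xC].
    by apply: connect1; rewrite /= !inE eqxx cA AB orbT.
  have /forall_inP/(_ _ cA)/forall_inP/(_ _ xC) := conC.
  apply: connect_sub => y z /and3P[yC zC yz]; apply: connect1.
  by rewrite /= !inE yC zC yz !orbT.
apply/forall_inP => x xD; apply/forall_inP => y yD.
by apply: connect_trans (toA y yD); rewrite eC toA.
Qed.

(** * The up-walks on the quotient and on the double cover *)

Section UpWalk.
Variables (R : realFieldType) (G : doubleCover).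
Implicit Types (u v : G) (A B : qnode G) (C : {set qnode G}) (k : int).

Lemma up_adj_sym k : symmetric (@up_adj G k).
Proof.
move=> A B; rewrite /up_adj /= eq_sym; congr (_ && _).
by apply: eq_existsb => D; rewrite [qedge A D && _]andbC.
Qed.

Lemma LP_neq0 A : (LP A)%:R != 0 :> R.
Proof. by rewrite pnatr_eq0 -lt0n LP_gt0. Qed.

Lemma RP_neq0 A : (RP A)%:R != 0 :> R.
Proof. by rewrite pnatr_eq0 -lt0n RP_gt0. Qed.

Lemma eq_cls u v : (cls u == cls v) = (u == v) || (u == neg v).
Proof.
apply/eqP/idP => [E|]; first by rewrite -mem_cls -E mem_cls eqxx.
by case/orP => /eqP ->; rewrite ?cls_neg.
Qed.

Lemma edge_negrE u v : edge u (neg v) = edge u v.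
Proof. by rewrite -!qedgeE cls_neg. Qed.

Lemma leafP A B : is_leaf A -> qedge A B = false.
Proof. by move=> /forallP/(_ B)/negbTE. Qed.

Lemma qup_walk_ge0 A B : 0 <= qup_walk R A B.
Proof.
rewrite /qup_walk; case: ifP => _; first by case: ifP.
by apply: sumr_ge0 => D _; rewrite divr_ge0 ?mulr_ge0.
Qed.

(** Turns up-adjacency into a positive transition, so that connectedness of a component becomes
    irreducibility of the walk. *)
Lemma qup_walk_gt0 A B D : qedge A D -> qedge B D -> 0 < qup_walk R A B.
Proof.
move=> AD BD; rewrite /qup_walk ifN; last first.
  by apply/negP => /(leafP D); rewrite AD.
rewrite (bigD1 D) ?AD //= ltr_pwDl //.
  by rewrite divr_gt0 ?mulr_gt0 ?ltr0n ?LP_gt0 ?RP_gt0.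
by apply: sumr_ge0 => E _; rewrite divr_ge0 ?mulr_ge0.
Qed.

Lemma qup_walk_balance A A' :
  (LP A)%:R * (RP A)%:R * qup_walk R A A' =
  (LP A')%:R * (RP A')%:R * qup_walk R A' A.
Proof.
have flow B B' : ~~ is_leaf B -> (LP B)%:R * (RP B)%:R * qup_walk R B B' =
    \sum_(D | qedge B D && qedge B' D)
      (RP B)%:R * (RP B')%:R * ((LP D)%:R / (RP D)%:R).
  move=> /negbTE nB; rewrite /qup_walk nB mulr_sumr; apply: eq_bigr => D _.
  by field; rewrite LP_neq0 RP_neq0.
(* No transition links a leaf and a non-leaf: the walk stays put at a leaf, and a leaf has no upper
   neighbour to share. *)
have out B B' : is_leaf B -> ~~ is_leaf B' ->
    qup_walk R B B' = 0 /\ qup_walk R B' B = 0.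
  move=> lB nB'; rewrite /qup_walk lB (negbTE nB'); split.
    by case: eqVneq nB' => // ->; rewrite lB.
  by rewrite big_pred0 // => D; rewrite (leafP D lB) andbF.
case: (boolP (is_leaf A)) (boolP (is_leaf A')) => [lA|nA] [lA'|nA'].
- rewrite /qup_walk lA lA' [A' == A]eq_sym.
  by case: eqVneq => [->|]; rewrite ?mulr0.
- by case: (out _ _ lA nA') => -> ->; rewrite !mulr0.
- by case: (out _ _ lA' nA) => -> ->; rewrite !mulr0.
- rewrite !flow //; apply: eq_big => [D|D _]; first exact: andbC.
  by rewrite [_%:R * _]mulrC.
Qed.

Lemma up_walk_balance u u' :
  (LP (cls u))%:R * (RP (cls u))%:R * up_walk R u u' =
  (LP (cls u'))%:R * (RP (cls u'))%:R * up_walk R u' u.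
Proof.
have flow v v' : ~~ is_leaf (cls v) ->
    (LP (cls v))%:R * (RP (cls v))%:R * up_walk R v v' =
    \sum_(w | [&& edge v w, edge v' w, sgn w v == 1 & sgn w v' == -1])
      (RP (cls v))%:R * (RP (cls v'))%:R * ((LP (cls w))%:R / (RP (cls w))%:R).
  move=> /negbTE nv; rewrite /up_walk nv mulr_sumr; apply: eq_bigr => w _.
  by field; rewrite LP_neq0 RP_neq0.
have out v v' : is_leaf (cls v) -> ~~ is_leaf (cls v') ->
    up_walk R v v' = 0 /\ up_walk R v' v = 0.
  move=> lv nv'; rewrite /up_walk lv (negbTE nv') !inE -eq_cls; split.
    by case: eqVneq nv' => // ->; rewrite lv.
  by rewrite big_pred0 // => w; rewrite -!qedgeE (leafP _ lv) andbF.
case: (boolP (is_leaf (cls u))) (boolP (is_leaf (cls u'))) => [lu|nu] [lu'|nu'].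
- rewrite /up_walk lu lu' !inE -!eq_cls [cls u' == _]eq_sym.
  by case: eqVneq => [->|]; rewrite ?mulr0.
- by case: (out _ _ lu nu') => -> ->; rewrite !mulr0.
- by case: (out _ _ lu' nu) => -> ->; rewrite !mulr0.
(* Replacing [w] by [neg w] flips both signatures, which exchanges the roles of [u] and [u'] in the
   summation condition and leaves the class of [w] unchanged. *)
- rewrite !flow // (reindex_inj (can_inj (@negK G))) /=.
  apply: eq_big => [w|w _]; last by rewrite cls_neg [(RP (cls u))%:R * _]mulrC.
  rewrite !edge_negrE andbCA; case: (boolP (edge u' w)) => //= e'.
  case: (boolP (edge u w)) => //= e.
  by rewrite !sgn_negl // andbC eqr_opp eqr_oppLR.
Qed.

Hypothesis strongG : strongly_graded G.

Lemma qedge_qlayer k A B :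
  qedge A B -> (B \in qlayer G (k + 1)) = (A \in qlayer G k).
Proof.
have [u ->] := cls_surj A; have [v ->] := cls_surj B.
by rewrite qedgeE !mem_qlayer => /strongG ->; rewrite (inj_eq (addIr 1)).
Qed.

(** Sum first over the target: the [RP] of the lower neighbours of [D] add up to [RP D], as [D] lies
    above [A] and is no root. What is left is the sum of [LP D / LP A] over the upper neighbours of
    [A]. *)
Lemma qup_walk_sum1 k A :
  A \in qlayer G k -> \sum_(B in qlayer G k) qup_walk R A B = 1.
Proof.
move=> Ak; rewrite /qup_walk; case: (boolP (is_leaf A)) => [lA|nA].
  rewrite (bigD1 A) //= eqxx big1 ?addr0 // => B /andP[_ /negbTE ->].
  by [].
rewrite (exchange_big_dep (fun D => qedge A D)) /=; last by move=> B D _ /andP[].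
rewrite (eq_bigr (fun D => (LP D)%:R / (LP A)%:R)) => [|D AD].
  rewrite -mulr_suml -natr_sum.
  have -> : (\sum_(D | qedge A D) LP D)%N = LP A by rewrite [RHS]LPE (negbTE nA).
  by rewrite divff ?LP_neq0.
rewrite (eq_bigl (fun B => qedge B D)) => [|B]; last first.
  rewrite AD /=; case: (boolP (qedge B D)) => [BD|]; last by rewrite andbF.
  by rewrite andbT -(qedge_qlayer k BD) (qedge_qlayer k AD).
rewrite -mulr_suml -mulr_sumr -natr_sum.
have -> : (\sum_(B | qedge B D) RP B)%N = RP D.
  rewrite [RHS]RPE ifN //; apply/forallPn; exists A; by rewrite negbK.
by rewrite invfM mulrACA divff ?RP_neq0 // mulr1.
Qed.

Variables (k : int) (C : {set qnode G}).
Hypothesis Ccomp : up_component k C.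

Lemma up_component_sub : C \subset qlayer G k.
Proof. by have /maxsetP[/andP[]] := Ccomp. Qed.

(** This is what keeps both walks inside the component. Since [up_adj] relates distinct nodes only,
    the case [A = A'] is split off. *)
Lemma up_component_closed A A' B :
  A \in C -> qedge A B -> qedge A' B -> A' \in C.
Proof.
move=> cA AB A'B; have [<- //|nAA'] := eqVneq A A'.
have Bk : B \in qlayer G (k + 1).
  by rewrite (qedge_qlayer k AB) (subsetP up_component_sub).
apply: (component_closed (@up_adj_sym k) Ccomp cA).
  by rewrite -(qedge_qlayer k A'B).
by rewrite /up_adj /= nAA'; apply/existsP; exists B; rewrite Bk AB.
Qed.

Lemma up_walk_component u u' :
  cls u \in C -> cls u' \notin C -> up_walk R u u' = 0.
Proof.
move=> uC u'C; rewrite /up_walk; case: ifP => _.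
  by rewrite !inE -eq_cls; case: eqVneq u'C => // ->; rewrite uC.
rewrite big_pred0 // => v; apply/negP => /and4P[uv u'v _ _].
by case/negP: u'C; apply: (@up_component_closed (cls u) _ (cls v)); rewrite ?qedgeE.
Qed.

Lemma qup_walk_component A A' :
  A \in C -> A' \notin C -> qup_walk R A A' = 0.
Proof.
move=> cA cA'; rewrite /qup_walk; case: ifP => _.
  by case: eqVneq cA' => // ->; rewrite cA.
rewrite big_pred0 // => B; apply/negP => /andP[AB A'B].
by case/negP: cA'; apply: (up_component_closed cA AB).
Qed.

(** Inside [C] this is the balance identity divided by the path count; across the boundary one side
    vanishes because the distribution is zero, the other because the walk cannot leave [C]. *)
Lemma quot_pi_reversible : reversible (qlayer G k) (@qup_walk R G) (quot_pi R C).
Proof.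
move=> A B _ _; rewrite /quot_pi.
case: (boolP (A \in C)) (boolP (B \in C)) => [cA|cA] [cB|cB].
- by rewrite ![_ / _ * _]mulrAC qup_walk_balance.
- by rewrite qup_walk_component // mulr0 mul0r.
- by rewrite [qup_walk R B A]qup_walk_component // mulr0 mul0r.
- by rewrite !mul0r.
Qed.

Lemma cover_pi_reversible : reversible (layer G k) (@up_walk R G) (cover_pi R C).
Proof.
move=> u v _ _; rewrite /cover_pi /quot_pi.
case: (boolP (cls u \in C)) (boolP (cls v \in C)) => [uC|uC] [vC|vC].
- rewrite ![_ / 2 * _]mulrAC ![_ / (npaths_through C)%:R * _]mulrAC.
  by rewrite up_walk_balance.
- by rewrite up_walk_component // mulr0 !mul0r.
- by rewrite [up_walk R v u]up_walk_component // mulr0 !mul0r.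
- by rewrite !mul0r.
Qed.

Lemma up_component_neq0 : C != set0.
Proof. by have /maxsetP[/and3P[]] := Ccomp. Qed.

Lemma npaths_through_gt0 : (0 < npaths_through C)%N.
Proof.
rewrite (npaths_throughE up_component_sub).
have [A cA] := set0Pn _ up_component_neq0.
by rewrite (bigD1 A) //= addn_gt0 muln_gt0 LP_gt0 RP_gt0.
Qed.

Lemma quot_pi_gt0 A : A \in C -> 0 < quot_pi R C A.
Proof.
move=> cA; rewrite /quot_pi cA.
by rewrite divr_gt0 ?mulr_gt0 ?ltr0n ?LP_gt0 ?RP_gt0 ?npaths_through_gt0.
Qed.

Lemma quot_pi_distribution : distribution_on C (quot_pi R C).
Proof.
split=> [A|A cA|]; rewrite /quot_pi.
- by case: ifP => // _; rewrite divr_ge0 ?mulr_ge0.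
- by rewrite (negbTE cA).
rewrite (eq_bigr (fun A => (LP A * RP A)%:R / (npaths_through C)%:R)) => [|A ->].
  rewrite -mulr_suml -natr_sum -(npaths_throughE up_component_sub) divff //.
  by rewrite pnatr_eq0 -lt0n npaths_through_gt0.
by rewrite natrM.
Qed.

(** Each class has exactly two lifts because [neg] has no fixed point; this accounts for the factor
    1/2 in [cover_pi]. *)
Lemma sum_cover_of (F : qnode G -> R) :
  \sum_(u in cover_of C) F (cls u) = (\sum_(A in C) F A) *+ 2.
Proof.
rewrite (partition_big (@cls G) (mem C)) => [|u]; last by rewrite inE.
rewrite -sumrMnl; apply: eq_bigr => A cA; have [w Aw] := cls_surj A.
rewrite (eq_bigr (fun => F A)) => [|u /andP[_ /eqP ->] //].
rewrite (eq_bigl (mem [set w; neg w])) => [|u].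
  by rewrite sumr_const cards2 eq_sym; case: eqP => // /neg_neq.
rewrite /= !inE -eq_cls -Aw; case: eqVneq => [->|]; last by rewrite andbF.
by rewrite (cA : A \in C).
Qed.

Lemma cover_pi_distribution : distribution_on (cover_of C) (cover_pi R C).
Proof.
have [pi0 piC pi1] := quot_pi_distribution; split=> [u|u|].
- by rewrite divr_ge0.
- by rewrite inE /cover_pi => /piC ->; rewrite mul0r.
by rewrite -mulr_suml sum_cover_of pi1 divff ?pnatr_eq0.
Qed.

Lemma quot_pi_the_stationary :
  the_stationary_distribution (qlayer G k) (@qup_walk R G) C (quot_pi R C).
Proof.
apply: reversible_the_stationary up_component_sub up_component_neq0 _ _ _ _ _ _.
- exact: qup_walk_ge0.
- exact: qup_walk_sum1.
- exact: quot_pi_distribution.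
- exact: quot_pi_gt0.
- exact: quot_pi_reversible.
have /maxsetP[/and3P[_ _ conC] _] := Ccomp.
move=> A B cA cB; have /forall_inP/(_ _ cA)/forall_inP/(_ _ cB) := conC.
apply: connect_sub => D E /and3P[DC EC /andP[_ /exists_inP[F _ /andP[DF EF]]]].
by apply: connect1; rewrite /= DC EC (qup_walk_gt0 DF EF).
Qed.

End UpWalk.

(** * Transport of chain properties along pointwise equality of walks and distributions *)

Section EqChains.
Variables (R : realFieldType) (T : finType) (S C : {set T}).
Variables (P P' : T -> T -> R) (mu mu' : T -> R).
Hypotheses (eqPP' : P =2 P') (eqmu : mu =1 mu').

Lemma eq_distribution_on : distribution_on C mu -> distribution_on C mu'.
Proof.
move=> [mu0 muC mu1]; split=> [x|x xC|].
- by rewrite -eqmu.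
- by rewrite -eqmu muC.
by rewrite -mu1; apply: eq_bigr => x _; rewrite eqmu.
Qed.

Lemma eq_reversible : reversible S P mu -> reversible S P' mu'.
Proof. by move=> rev x y xS yS; rewrite -!eqmu -!eqPP' rev. Qed.

Lemma eq_stationary : stationary S P mu -> stationary S P' mu'.
Proof.
move=> st y yS; rewrite -eqmu -st //.
by apply: eq_bigr => x _; rewrite eqmu eqPP'.
Qed.

End EqChains.

Lemma eq_the_stationary_distribution (R : realFieldType) (T : finType)
    (S C : {set T}) (P P' : T -> T -> R) (mu mu' : T -> R) :
  P =2 P' -> mu =1 mu' ->
  the_stationary_distribution S P C mu -> the_stationary_distribution S P' C mu'.
Proof.
move=> PP' mm' [mud must uni]; split.
- exact: eq_distribution_on mud.
- exact: eq_stationary must.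
move=> nu nud nust x; rewrite -mm'; apply: uni => //.
by apply: eq_stationary nust => // y z; rewrite PP'.
Qed.

(** * Duality: the opposite double cover exchanges up and down *)

Section Opposite.
Variable G : doubleCover.

Let op_card : (0 < #|node G|)%N. Proof. by case: G. Qed.

Let op_sgn_unit (u v : G) : edge v u -> - sgn u v = 1 \/ - sgn u v = -1.
Proof. by move=> /sgn_unit[->|->]; [right|left; rewrite opprK]. Qed.

Let op_edge_dim (u v : G) : edge v u -> - Defs.dim u < - Defs.dim v.
Proof. by rewrite ltrN2; apply: edge_dim. Qed.

Let op_sgn_negl (u v : G) : edge v u -> - sgn u (neg v) = - - sgn u v.
Proof. by move=> /sgn_negr ->. Qed.

Let op_sgn_negr (u v : G) : edge v u -> - sgn (neg u) v = - - sgn u v.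
Proof. by move=> /sgn_negl ->. Qed.

Let op_dim_neg (u : G) : - Defs.dim (neg u) = - Defs.dim u.
Proof. by rewrite dim_neg. Qed.

(* The sign change turns the condition [u : t] = -1, [u' : t] = 1 of the
   down-walk into the condition of the up-walk. *)
Definition op_cover : doubleCover :=
  @DoubleCover (node G) (fun u v => edge v u) (fun v u => - sgn u v)
    (fun u => - Defs.dim u) (@neg G) op_card op_sgn_unit (@negK G) (@neg_neq G)
    op_edge_dim (fun u v => @edge_negr G v u) (fun u v => @edge_negl G v u)
    op_sgn_negl op_sgn_negr op_dim_neg.

Implicit Types (A B : qnode G) (C : {set qnode G}) (k : int).

Lemma op_strongly_graded : strongly_graded G -> strongly_graded op_cover.
Proof. by move=> strongG u v /strongG /= ->; rewrite opprD subrK. Qed.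

(** The type [qnode] depends only on the nodes and on [neg], so both covers have the same quotient
    nodes up to conversion and their edges can be compared directly. *)
Lemma qedge_op A B : @qedge op_cover A B = qedge B A.
Proof.
by have [u ->] := cls_surj A; have [v ->] := cls_surj B;
  rewrite [RHS]qedgeE; apply: (@qedgeE op_cover u v).
Qed.

Lemma LP_op A : @LP op_cover A = RP A.
Proof. exact: eq_sink_count qedge_op A. Qed.

Lemma RP_op A : @RP op_cover A = LP A.
Proof. by apply: eq_sink_count => B D; apply: qedge_op. Qed.

Lemma is_leaf_op A : @is_leaf op_cover A = is_root A.
Proof. exact: eq_sink qedge_op A. Qed.

Lemma qlayer_op k : qlayer op_cover (- k) = qlayer G k.
Proof.
apply/setP => A; have [u ->] := @cls_surj G A.
rewrite [RHS](@mem_qlayer G k u) -(eqr_opp (Defs.dim u)).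
exact: (@mem_qlayer op_cover (- k) u).
Qed.

Lemma up_adj_op k : @up_adj op_cover (- k) =2 @down_adj G k.
Proof.
move=> A B; rewrite /up_adj /down_adj /=; congr (_ && _).
apply: eq_existsb => D; rewrite !qedge_op; congr (_ && _).
(* The layer above [- k] in the opposite cover is the layer below [k], as [- k + 1] is
   [- (k - 1)]. *)
by rewrite -qlayer_op opprB addrC.
Qed.

Lemma up_component_op k C : @up_component op_cover (- k) C = down_component k C.
Proof.
apply: maxset_eq => D; rewrite qlayer_op; congr (_ && (_ && _)).
apply: eq_forallb => A; congr (_ ==> _).
apply: eq_forallb => B; congr (_ ==> _).
by apply: eq_connect => A' B'; rewrite /= -up_adj_op.
Qed.

Variable R : realFieldType.

Lemma qup_walk_op A B : @qup_walk R op_cover A B = qdown_walk R A B.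
Proof.
rewrite /qup_walk /qdown_walk is_leaf_op; case: ifP => // _.
by apply: eq_big => [D|D _]; rewrite ?qedge_op ?LP_op ?RP_op.
Qed.

Lemma up_walk_op (u v : G) : @up_walk R op_cover u v = down_walk R u v.
Proof.
rewrite /up_walk /down_walk [is_leaf _]is_leaf_op; case: ifP => // _.
apply: eq_big => [t|t _] /=; first by rewrite eqr_oppLR eqr_opp.
by rewrite !LP_op !RP_op.
Qed.

(** Both path counts are sums of [LP * RP] over [C], which is symmetric in the two factors; this
    replaces a bijection by reversal of paths. *)
Lemma quot_pi_op k C A : C \subset qlayer G k ->
  @quot_pi R op_cover C A = quot_pi R C A.
Proof.
move=> Ck; have npathsE : @npaths_through op_cover C = npaths_through C.
  rewrite (npaths_throughE Ck) (@npaths_throughE op_cover (- k)) ?qlayer_op //.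
  by apply: eq_bigr => B _; rewrite LP_op RP_op mulnC.
by rewrite /quot_pi LP_op RP_op npathsE [(RP A)%:R * _]mulrC.
Qed.

End Opposite.

Theorem theorem1p48 (R : realFieldType) (G : doubleCover)
    (strongG : strongly_graded G) (k : int) (C : {set qnode G}) :
  (up_component k C ->
     [/\ distribution_on C (quot_pi R C),
         reversible (qlayer G k) (@qup_walk R G) (quot_pi R C),
         the_stationary_distribution
           (qlayer G k) (@qup_walk R G) C (quot_pi R C),
         distribution_on (cover_of C) (cover_pi R C) &
         reversible (layer G k) (@up_walk R G) (cover_pi R C)]) /\
  (down_component k C ->
     [/\ distribution_on C (quot_pi R C),
         reversible (qlayer G k) (@qdown_walk R G) (quot_pi R C),
         the_stationary_distribution
           (qlayer G k) (@qdown_walk R G) C (quot_pi R C),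
         distribution_on (cover_of C) (cover_pi R C) &
         reversible (layer G k) (@down_walk R G) (cover_pi R C)]).
Proof.
split=> Ccomp.
  split.
  - exact: quot_pi_distribution Ccomp.
  - exact: quot_pi_reversible.
  - exact: quot_pi_the_stationary.
  - exact: cover_pi_distribution Ccomp.
  - exact: cover_pi_reversible.
(* The down half is the up half for [op_cover G] in dimension [- k], carried back through the
   pointwise equalities. *)
have Ck : C \subset qlayer G k by have /maxsetP[/andP[]] := Ccomp.
have opcomp : @up_component (op_cover G) (- k) C by rewrite up_component_op.
have opstrong := op_strongly_graded strongG.
have qpi A := quot_pi_op R A Ck.
have pi (u : G) : @cover_pi R (op_cover G) C u = cover_pi R C u.
  by rewrite /cover_pi -qpi.
split.
- exact: eq_distribution_on qpi (quot_pi_distribution R opcomp).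
- rewrite -qlayer_op.
  exact: eq_reversible (@qup_walk_op G R) qpi (quot_pi_reversible R opstrong opcomp).
- rewrite -qlayer_op.
  exact: eq_the_stationary_distribution (@qup_walk_op G R) qpi
    (quot_pi_the_stationary R opstrong opcomp).
- exact: eq_distribution_on pi (cover_pi_distribution R opcomp).
have -> : layer G k = layer (op_cover G) (- k).
  by apply/setP => u; rewrite !inE /= eqr_opp.
exact: eq_reversible (@up_walk_op G R) pi (cover_pi_reversible R opstrong opcomp).
Qed.
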